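(* Let $\gamma\in(1,2]$. Assume that $\alpha>0$. Let $x$ be a solution of $$\ddot{x}(t)+\frac{\alpha}{t}\dot{x}(t)+\nabla F(x(t))=0$$ with $F(x)=|x|^\gamma$ ($x\in\mathbb{R}$), $|x(t_0)|<1$ and $\dot x(t_0)=0$, where $$t_0>\sqrt{\max\left(0,\frac{\alpha\gamma\left(\alpha-1-\frac{2}{\gamma}\right)}{(\gamma+2)^2}\right)}.$$ Then there exists $K>0$ such that for any $T>0$ there exists $t\geq T$ such that $$F(x(t))-F^*\geq\frac{K}{t^{\frac{2\gamma\alpha}{\gamma+2}}}.$$
   Context: Here $F:\mathbb{R}\to\mathbb{R}$ and $F^*:=\inf F$ (so $F^*=0$). The solution $x$ is defined on $[t_0,+\infty)$. Standing assumption: for any initial conditions $(x_0,v_0)$, the Cauchy problem for the differential equation with $x(t_0)=x_0$, $\dot x(t_0)=v_0$ has a unique global solution.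
   Formalization: The formal theorem additionally assumes x(t_0) ≠ 0; if x(t_0) = 0 and the initial velocity is 0, the unique solution is x ≡ 0, so F(x(t)) − F* = 0 for all t and the claimed lower bound fails. *)

(* Defs.v *)
From HB Require Import structures.
From mathcomp Require Import all_boot all_order all_algebra.
From mathcomp Require Import all_classical all_reals all_analysis.

Set Implicit Arguments.
Unset Strict Implicit.
Unset Printing Implicit Defensive.

Import Order.TTheory GRing.Theory Num.Theory.
Import numFieldNormedType.Exports.

Local Open Scope classical_set_scope.
Local Open Scope ring_scope.

(* Relative to [D = `[t0, +oo[], this is the usual derivative at [t > t0] and
   the right derivative at [t0]. The library's [derive1] is two-sided, so at
   [t0] it would depend on values of [f] outside [D]. *)
Definition is_derive1_within (R : realType) (D : set R) (f : R -> R)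
    (t l : R) : Prop :=
  (f s - f t) / (s - t) @[s --> within D t^'] --> l.

(* [x] solves x'' + (alpha / t) x' + F'(x) = 0 on [t0, +oo[; only the values
   of [x] on this half-line matter. *)
Definition ode_solution (R : realType) (alpha t0 : R) (F x : R -> R) : Prop :=
  exists x' x'' : R -> R, forall t : R, t0 <= t ->
    [/\ is_derive1_within `[t0, +oo[ x t (x' t),
        is_derive1_within `[t0, +oo[ x' t (x'' t) &
        x'' t + alpha / t * x' t + derive1 F (x t) = 0].

Definition cauchy_solution (R : realType) (alpha t0 : R) (F : R -> R)
    (x0 v0 : R) (x : R -> R) : Prop :=
  [/\ ode_solution alpha t0 F x,
      x t0 = x0 &
      is_derive1_within `[t0, +oo[ x t0 v0].

Definition cauchy_well_posed (R : realType) (alpha t0 : R) (F : R -> R) : Prop :=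
  forall x0 v0 : R,
    (exists x, cauchy_solution alpha t0 F x0 v0 x) /\
    (forall x y, cauchy_solution alpha t0 F x0 v0 x ->
       cauchy_solution alpha t0 F x0 v0 y ->
       forall t, t0 <= t -> x t = y t).

(* Main.v *)
Require Import Defs.
From HB Require Import structures.
From mathcomp Require Import all_boot all_order all_algebra.
From mathcomp Require Import all_classical all_reals all_analysis.
From mathcomp Require Import ring lra.

Set Implicit Arguments.
Unset Strict Implicit.
Unset Printing Implicit Defensive.

Import Order.TTheory GRing.Theory Num.Theory.
Import numFieldNormedType.Exports.

Local Open Scope classical_set_scope.
Local Open Scope ring_scope.

(** Write v for the derivative of x, E = F(x) + v^2/2 for the energy,
    c = 2 alpha / (gamma + 2) and p = gamma c, which is the exponent of the
    statement. The energy satisfies E' = - (alpha / t) v^2.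

    The exponent p comes from a virial heuristic: since x F'(x) = gamma F(x), an
    oscillating trajectory has on average v^2 = gamma F(x), hence
    v^2 / 2 = gamma / (gamma + 2) E, which turns the energy balance into
    E' = - (p / t) E. To make this exact, the oscillating part of v^2 is
    absorbed by a multiple of x v, as in
      V = t^2 E + c t x v + d x^2.
    With the right constant d, all terms but one recombine into V itself:
    t V' = (2 - p) (V - d x^2), see [is_derive_virial].

    Because the energy decreases and starts below 1, |x| stays below 1, so
    x^2 <= |x|^gamma = F(x) because gamma <= 2. Hence for large t the quantity V
    is comparable to t^2 E, and the error d x^2 is smaller than V by a factor of
    order t^-2, which is integrable against dt / t. So t^(p-2) V, damped by the
    harmless factor 1 - C / t^2, is eventually nondecreasing. It is eventually
    positive because E never vanishes: t^(2 alpha) E is nondecreasing. This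
    gives E >= m t^-p for large t and some m > 0 ([energy_powR_lower]).

    It remains to pass from E to F(x). If F(x) were below (m / 2) t^-p on
    [t, 2t], then v^2 would be at least m (2t)^-p there, so by the mean value
    theorem x would move by at least t sqrt(m) (2t)^(-p/2) between t and 2t; but
    x^2 <= F(x) confines it to an interval whose length is of order t^(-p/2).
    These are incompatible for large t ([potential_lower_of_energy]). *)

(** * Derivatives relative to a half-line *)

Lemma is_derive1_within_cvg (R : realType) (t0 t l : R) (f : R -> R) :
  is_derive1_within `[t0, +oo[ f t l ->
  f s @[s --> within `[t0, +oo[ t^'] --> f t.
Proof.
move=> fl.
have -> : f t = l * (t - t) + f t by rewrite subrr mulr0 add0r.
have : (f s - f t) / (s - t) * (s - t) + f t @[s --> within `[t0, +oo[ t^']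
    --> l * (t - t) + f t.
  apply: cvgD; last exact: cvg_cst.
  apply: cvgM; first exact: fl.
  apply: cvgB; last exact: cvg_cst.
  apply: (cvg_trans _ (nbhs_dnbhs (x := t))).
  exact: cvg_within.
apply: cvg_trans; apply: near_eq_cvg.
rewrite /= near_withinE near_withinE; near=> s => st _.
by rewrite divfK ?subrK// subr_eq0.
Unshelve. all: by end_near. Qed.

Lemma is_derive1_within_continuous (R : realType) (t0 : R) (f f' : R -> R) :
  (forall t, t0 <= t -> is_derive1_within `[t0, +oo[ f t (f' t)) ->
  {within `[t0, +oo[, continuous f}.
Proof.
move=> ff'; apply/subspace_continuousP => t /=; rewrite in_itv/= andbT => t0t.
have := is_derive1_within_cvg (ff' t t0t).
move=> /cvgrPdist_lt ft; apply/cvgrPdist_lt => e e0.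
have := ft _ e0; rewrite near_withinE near_withinE near_withinE.
move=> h; near=> s => ds.
have [->|st] := eqVneq s t; first by rewrite subrr normr0.
by apply: (near h s) => //.
Unshelve. all: by end_near. Qed.

Lemma is_derive1_within_interior (R : realType) (t0 t l : R) (f : R -> R) :
  t0 < t -> is_derive1_within `[t0, +oo[ f t l -> is_derive t 1 f l.
Proof.
move=> t0t fl; apply/is_derive1_caratheodory.
exists (fun s => if s == t then l else (f s - f t) / (s - t)); split.
- move=> s; case: eqVneq => [->|st]; first by rewrite !subrr mulr0.
  by rewrite divfK// subr_eq0.
- apply/cvgrPdist_lt => e e0; rewrite eqxx.
  move/cvgrPdist_lt : fl => /(_ _ e0); rewrite near_withinE near_withinE.
  move=> h; near=> s; case: eqVneq => [_|st]; first by rewrite subrr normr0.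
  apply: (near h s) => //=; rewrite in_itv/= andbT ltW//.
  by near: s; exact: lt_nbhsr.
- by rewrite eqxx.
Unshelve. all: by end_near. Qed.

Lemma is_derive1_within_unique (R : realType) (t0 l l' : R) (f : R -> R) :
  is_derive1_within `[t0, +oo[ f t0 l -> is_derive1_within `[t0, +oo[ f t0 l' ->
  l = l'.
Proof.
rewrite /is_derive1_within.
have right_filter : t0^'+ `=>` within `[t0, +oo[ t0^'.
  move=> P PD; suff : \forall s \near t0^'+, P s by [].
  have : \forall s \near within `[t0, +oo[ t0^', P s by [].
  rewrite /at_right !near_withinE => h; near=> s => t0s.
  apply: (near h s) => //=; last by rewrite in_itv/= andbT ltW.
  by rewrite gt_eqF.
move=> /(cvg_trans (cvg_app _ right_filter)) fl.
move=> /(cvg_trans (cvg_app _ right_filter)) fl'.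
exact: (cvg_unique _ fl fl').
Unshelve. all: by end_near. Qed.

Lemma is_derive_ge0_homo (R : realType) (a : R) (f f' : R -> R) :
  (forall t, a < t -> is_derive t 1 f (f' t)) ->
  (forall t, a < t -> 0 <= f' t) ->
  {within `[a, +oo[, continuous f} ->
  forall s t, a <= s -> s <= t -> f s <= f t.
Proof.
move=> ff' f'_ge0 fc; apply: ger0_derive1_ndecry => // t.
  by rewrite in_itv/= andbT => /ff'[].
rewrite in_itv/= andbT => a_lt_t; rewrite derive1E.
by have [_ ->] := ff' _ a_lt_t; exact: f'_ge0.
Qed.

(** * Powers and the potential |y|^gamma *)

Lemma is_derive_abs_powR (R : realType) (gamma y : R) : 1 < gamma ->
  is_derive y 1 (fun z : R => `|z| `^ gamma)
    (gamma * (Num.sg y * `|y| `^ (gamma - 1))).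
Proof.
move=> gamma1; have [y0|y0|->] := ltgtP y 0.
- apply: (@near_eq_is_derive _ _ _ ((@powR R ^~ gamma) \o -%R)).
    near=> z; rewrite /= ltr0_norm//; near: z; exact: lt_nbhsl.
  rewrite ltr0_sg// ltr0_norm//.
  have -> : gamma * (-1 * (- y) `^ (gamma - 1)) =
    (gamma * (- y) `^ (gamma - 1)) * (-1) by ring.
  apply: is_derive1_comp; apply: is_derive1_powR; by rewrite oppr_gt0.
- apply: (@near_eq_is_derive _ _ _ (@powR R ^~ gamma)).
    near=> z; rewrite gtr0_norm//; near: z; exact: lt_nbhsr.
  rewrite gtr0_sg// gtr0_norm// mul1r.
  exact: is_derive1_powR.
(* At 0 the slope of the chord is sg z |z|^(gamma - 1), which tends to 0. *)
- rewrite sgr0 mul0r mulr0; apply/is_derive1_caratheodory.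
  exists (fun z => Num.sg z * `|z| `^ (gamma - 1)); split.
  + move=> z; rewrite normr0 powR0 ?gt_eqF//; last by lra.
    by rewrite !subr0 mulrAC -normrEsg mulr_powRB1//; lra.
  + have gamma10 : 0 < gamma - 1 by lra.
    apply/cvgrPdist_lt => e e0; rewrite sgr0 mul0r; near=> z.
    rewrite sub0r normrN normrM [X in _ * X]ger0_norm ?powR_ge0//.
    have [->|z0] := eqVneq z 0; first by rewrite sgr0 normr0 mul0r.
    rewrite normr_sg z0 mul1r.
    have -> : e = (e `^ (gamma - 1)^-1) `^ (gamma - 1).
      by rewrite -powRrM mulVf ?gt_eqF// powRr1// ltW.
    apply: gt0_ltr_powR => //; rewrite ?nnegrE ?powR_ge0//.
    near: z; by apply: (@nbhs0_lt _ R); exact: powR_gt0.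
  + by rewrite sgr0 mul0r.
Unshelve. all: by end_near. Qed.

(** Euler's identity for a function that is positively homogeneous of degree
    gamma. *)
Lemma abs_powR_euler (R : realType) (gamma y : R) : 1 < gamma ->
  y * derive1 (fun z : R => `|z| `^ gamma) y = gamma * `|y| `^ gamma.
Proof.
move=> gamma1; rewrite derive1E.
rewrite (derive_val (is_derive := is_derive_abs_powR y gamma1)).
by rewrite mulrCA (mulrA y) (mulrC y) -normrEsg mulr_powRB1//; lra.
Qed.

Lemma sqr_le_abs_powR (R : realType) (gamma y : R) :
  0 < gamma -> gamma <= 2 -> `|y| <= 1 -> y ^+ 2 <= `|y| `^ gamma.
Proof.
move=> gamma0 gamma2 y1; rewrite -real_normK ?num_real//.
have [->|y0] := eqVneq y 0; first by rewrite normr0 powR0 ?expr0n// gt_eqF.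
by rewrite -powR_mulrn// ger_powR// normr_gt0 y0.
Qed.

Lemma inf_abs_powR (R : realType) (gamma : R) : gamma != 0 ->
  inf (range (fun z : R => `|z| `^ gamma)) = 0.
Proof.
move=> gamma0; have zero_mem : range (fun z : R => `|z| `^ gamma) 0.
  by exists 0 => //; rewrite normr0 powR0.
have lower : lbound (range (fun z : R => `|z| `^ gamma)) 0.
  by move=> _ [z _ <-]; exact: powR_ge0.
apply/eqP; rewrite eq_le; apply/andP; split.
  by apply: ge_inf => //; exists 0.
by apply: lb_le_inf => //; exists 0.
Qed.

Lemma powR_pred (R : realType) (u a : R) : 0 < u -> u `^ a = u * u `^ (a - 1).
Proof.
move=> u0; have u_neq0 : u != 0 by rewrite gt_eqF.
by rewrite powRB ?u_neq0 ?implybT// powRr1 ?ltW// mulrC divfK.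
Qed.

(** * Energy of a damped motion *)

(** The initial time is excluded, so that two-sided derivatives can be used;
    what happens there is carried by continuity on the closed half-line. *)
Definition damped_motion (R : realType) (alpha t0 : R) (F x v : R -> R) : Prop :=
  forall t, t0 < t -> is_derive t 1 x (v t) /\
    is_derive t 1 v (- (alpha / t * v t) - derive1 F (x t)).

Definition energy (R : realType) (F x v : R -> R) (t : R) : R :=
  F (x t) + v t ^+ 2 / 2.

Lemma is_derive_energy (R : realType) (alpha t0 t : R) (F x v : R -> R) :
  (forall y, derivable F y 1) -> damped_motion alpha t0 F x v -> t0 < t ->
  is_derive t 1 (energy F x v) (- (alpha / t * v t ^+ 2)).
Proof.
move=> dF motion t0t; have [dx dv] := motion _ t0t.
have dFx : is_derive (x t) 1 F (derive1 F (x t)).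
  by rewrite derive1E; exact/derivableP.
have := is_deriveD (is_derive1_comp dFx dx)
  (is_deriveM (is_deriveM dv dv) (is_derive_cst (2^-1 : R) t 1)).
move=> h; refine (is_derive_eq h _).
by rewrite /GRing.scale/= ?fctE; move: (alpha / t) => r; field.
Qed.

Lemma energy_within_continuous (R : realType) (t0 : R) (F x v : R -> R) :
  (forall y, derivable F y 1) ->
  {within `[t0, +oo[, continuous x} -> {within `[t0, +oo[, continuous v} ->
  {within `[t0, +oo[, continuous (energy F x v)}.
Proof.
move=> dF xc vc.
have -> : energy F x v = (F \o x) + v * v * cst (2^-1) by [].
move=> t; apply: continuousD.
  apply: continuous_comp; first exact: xc.
  exact/differentiable_continuous/derivable1_diffP.
apply: continuousM; last exact: cvg_cst.
by apply: continuousM; exact: vc.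
Qed.

Lemma energy_nonincreasing (R : realType) (alpha t0 : R) (F x v : R -> R) :
  0 <= alpha -> 0 <= t0 ->
  (forall y, derivable F y 1) -> damped_motion alpha t0 F x v ->
  {within `[t0, +oo[, continuous x} -> {within `[t0, +oo[, continuous v} ->
  forall s t, t0 <= s -> s <= t -> energy F x v t <= energy F x v s.
Proof.
move=> a0 t00 dF motion xc vc s t t0s st; rewrite -lerN2.
have dE u : t0 < u ->
    is_derive u 1 (- energy F x v) (alpha / u * v u ^+ 2).
  move=> t0u; apply: is_derive_eq.
    by apply: is_deriveN; exact: is_derive_energy dF motion t0u.
  by rewrite opprK.
apply: (is_derive_ge0_homo dE) t0s st => [u t0u|u].
  by rewrite mulr_ge0 ?sqr_ge0// divr_ge0// ltW// (le_lt_trans _ t0u).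
apply: continuousN; exact: energy_within_continuous.
Qed.

(** Friction removes at most the kinetic part v^2 / 2 <= E, so the energy
    decays no faster than t^(- 2 alpha); in particular the motion never comes to
    rest at the minimum of F in finite time. *)
Lemma energy_gt0 (R : realType) (alpha t0 : R) (F x v : R -> R) :
  0 <= alpha -> 0 < t0 -> (forall y, 0 <= F y) ->
  (forall y, derivable F y 1) -> damped_motion alpha t0 F x v ->
  {within `[t0, +oo[, continuous x} -> {within `[t0, +oo[, continuous v} ->
  0 < energy F x v t0 -> forall t, t0 <= t -> 0 < energy F x v t.
Proof.
move=> a0 t00 F0 dF motion xc vc E0 t t0t.
pose f u := u `^ (2 * alpha) * energy F x v u.
pose f' u := 2 * alpha * u `^ (2 * alpha - 1) * F (x u).
have df u : t0 < u -> is_derive u 1 f (f' u).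
  move=> t0u; have u0 := lt_trans t00 t0u.
  have h := is_deriveM (is_derive1_powR (2 * alpha) u0)
    (is_derive_energy dF motion t0u).
  refine (is_derive_eq h _); rewrite /GRing.scale/= /f' /energy.
  rewrite {1}(powR_pred (2 * alpha) u0).
  by field; rewrite gt_eqF.
have f'_ge0 u : t0 < u -> 0 <= f' u.
  by move=> t0u; rewrite !mulr_ge0 ?powR_ge0.
have fc : {within `[t0, +oo[, continuous f}.
  have -> : f = (@powR R ^~ (2 * alpha)) * energy F x v by [].
  move=> u; apply: continuousM; last exact: energy_within_continuous.
  move: u; apply: derivable_within_continuous => u.
  rewrite in_itv/= andbT => t0u.
  by apply: derivable_powR; rewrite in_itv/= andbT (lt_le_trans t00).
have := is_derive_ge0_homo df f'_ge0 fc (lexx t0) t0t.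
rewrite /f => le_f.
have : 0 < t `^ (2 * alpha) * energy F x v t.
  by apply: lt_le_trans le_f; rewrite mulr_gt0// powR_gt0.
by rewrite pmulr_rgt0// powR_gt0// (lt_le_trans t00).
Qed.

(** * A corrected energy with an exact decay rate *)

(** Since (x v)' contains v^2 - gamma F(x), the cross term can compensate the
    deviation of v^2 from its mean gamma F(x) along an oscillation. *)
Definition virial (R : realType) (c d : R) (F x v : R -> R) (t : R) : R :=
  t ^+ 2 * energy F x v t + c * (t * (x t * v t)) + d * x t ^+ 2.

(** The value of c balances the v^2 terms (c + gamma c / 2 = alpha), Euler's
    identity then makes the F(x) terms match, and d is chosen so that the x v
    terms do. *)
Lemma is_derive_virial (R : realType) (gamma alpha t0 t : R) (F x v : R -> R)
  (c := 2 * alpha / (gamma + 2)) (d := c * (alpha + 1 - gamma * c) / 2) :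
  0 < gamma + 2 -> 0 < t ->
  (forall y, derivable F y 1) ->
  x t * derive1 F (x t) = gamma * F (x t) ->
  damped_motion alpha t0 F x v -> t0 < t ->
  is_derive t 1 (virial c d F x v)
    ((2 - gamma * c) / t * (virial c d F x v t - d * x t ^+ 2)).
Proof.
move=> gamma2 t_gt0 dF euler motion t0t; have [dx dv] := motion _ t0t.
have did := is_derive_id t (1 : R).
have h := is_deriveD (is_deriveD
  (is_deriveM (is_deriveM did did) (is_derive_energy dF motion t0t))
  (is_deriveM (is_derive_cst c t 1) (is_deriveM did (is_deriveM dx dv))))
  (is_deriveM (is_derive_cst d t 1) (is_deriveM dx dx)).
refine (is_derive_eq h _); rewrite /GRing.scale/= ?fctE /virial/=.
rewrite mulr0 addr0 mulr0 addr0.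
have cE : c * (gamma + 2) = 2 * alpha by rewrite /c divfK// gt_eqF.
(* Once alpha is expressed through c, both sides differ by a multiple of Euler's
   identity, so only polynomial arithmetic remains. *)
have dE : d = c * (alpha + 1 - gamma * c) / 2 by [].
have aE : alpha = c * (gamma + 2) / 2 by lra.
clear h; clearbody d c.
transitivity ((2 - gamma * c) * (t * energy F x v t + c * (x t * v t))); last first.
  by field; rewrite gt_eqF.
apply/eqP; rewrite -subr_eq0; apply/eqP.
transitivity (c * t * (gamma * F (x t) - x t * derive1 F (x t))).
  by rewrite /energy dE aE; field; rewrite gt_eqF.
by rewrite euler subrr mulr0.
Qed.

(** By Young's inequality the cross term is at most a quarter of
    t^2 (x^2 + v^2), and x^2 is controlled by F(x). *)
Lemma virial_bounds (R : realType) (c d t : R) (F x v : R -> R) :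
  0 <= c -> 0 <= d -> 1 <= t -> 2 * c <= t -> 2 * d <= t ->
  x t ^+ 2 <= F (x t) ->
  t ^+ 2 * energy F x v t / 2 <= virial c d F x v t
      <= 2 * (t ^+ 2 * energy F x v t).
Proof.
move=> c0 d0 t1 ct dt xF; rewrite /virial /energy.
move: (x t) (v t) (F (x t)) xF => X V U XU.
have U0 : 0 <= U by rewrite (le_trans _ XU)// sqr_ge0.
have ctt : 2 * (c * t) <= t ^+ 2 by nra.
have ct0 : 0 <= c * t by nra.
have dtt : 2 * d <= t ^+ 2 by nra.
have cross : `|c * (t * (X * V))| <= t ^+ 2 / 4 * (X ^+ 2 + V ^+ 2).
  have -> : c * (t * (X * V)) = (c * t) * (X * V) by ring.
  rewrite normrM (ger0_norm ct0).
  have XV : `|X * V| <= (X ^+ 2 + V ^+ 2) / 2.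
    have := sqr_ge0 (X - V); have := sqr_ge0 (X + V).
    by rewrite sqrrB sqrrD ler_norml => ? ?; apply/andP; split; lra.
  apply: (@le_trans _ _ ((t ^+ 2 / 2) * ((X ^+ 2 + V ^+ 2) / 2))).
    by apply: ler_pM => //; lra.
  have : 0 <= t ^+ 2 * (X ^+ 2 + V ^+ 2) by rewrite mulr_ge0 ?addr_ge0 ?sqr_ge0.
  lra.
have tXU : t ^+ 2 * X ^+ 2 <= t ^+ 2 * U by rewrite ler_wpM2l ?sqr_ge0.
have dX : 0 <= 2 * (d * X ^+ 2) <= t ^+ 2 * X ^+ 2.
  by rewrite mulrA mulr_ge0 ?sqr_ge0 ?mulr_ge0//= ler_wpM2r ?sqr_ge0.
have tV : 0 <= t ^+ 2 * V ^+ 2 by rewrite mulr_ge0 ?sqr_ge0.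
have tU : 0 <= t ^+ 2 * U by rewrite mulr_ge0 ?sqr_ge0.
move: cross; rewrite ler_norml => /andP[cross1 cross2].
move: dX => /andP[dX1 dX2].
apply/andP; split; lra.
Qed.

(** Monotonicity is proved for Phi = t^(p-2) (1 - C / t^2) V, with V the virial
    energy. Up to the factor t^(p-5), its derivative is
      (t^2 - C) d (p - 2) x^2 + 2 C V.
    The first term has no definite sign; the second one, which comes from the
    damping factor 1 - C / t^2, is at least C t^2 x^2 and compensates it. *)
Lemma energy_powR_lower (R : realType) (gamma alpha t0 : R) (F x v : R -> R) :
  0 < gamma -> gamma <= 2 -> 0 <= alpha -> 0 < t0 ->
  (forall y, derivable F y 1) ->
  (forall y, y * derive1 F y = gamma * F y) ->
  damped_motion alpha t0 F x v ->
  (forall t, t0 <= t -> x t ^+ 2 <= F (x t)) ->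
  (forall t, t0 <= t -> 0 < energy F x v t) ->
  exists m T : R, [/\ 0 < m, t0 <= T & forall t, T <= t ->
    m <= t `^ (gamma * (2 * alpha / (gamma + 2))) * energy F x v t].
Proof.
move=> gamma0 gamma2 alpha0 t00 dF euler motion sqrF E0.
set c := 2 * alpha / (gamma + 2); set p := gamma * c.
pose d := c * (alpha + 1 - p) / 2.
have gamma2_gt0 : 0 < gamma + 2 by lra.
have c0 : 0 <= c by rewrite /c divr_ge0 ?mulr_ge0// ltW.
have pE : alpha + 1 - p = 1 + c * (2 - gamma) / 2.
  by rewrite /p /c; field; rewrite gt_eqF.
have d0 : 0 <= d.
  have : 0 <= c * (2 - gamma) by rewrite mulr_ge0// subr_ge0.
  by move=> ?; rewrite /d pE divr_ge0// mulr_ge0//; lra.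
pose C := d * `|p - 2|.
have C0 : 0 <= C by rewrite mulr_ge0.
pose Phi t := t `^ (p - 4) * ((t ^+ 2 - C) * virial c d F x v t).
pose Phi' t := t `^ (p - 4 - 1) * (2 * C * virial c d F x v t +
  (t ^+ 2 - C) * (p - 2) * d * x t ^+ 2).
(* Past T the bounds on V hold and 1 - C / t^2 is positive: t >= 1 makes
   t^2 >= t. *)
pose T := t0 + 1 + 2 * c + 2 * d + C.
have T_le t : T <= t -> [/\ t0 < t, 1 <= t, 2 * c <= t, 2 * d <= t & C < t ^+ 2].
  by rewrite /T => Tt; split; nra.
have dPhi t : t0 < t -> is_derive t 1 Phi (Phi' t).
  move=> t0t; have t_gt0 := lt_trans t00 t0t.
  have did := is_derive_id t (1 : R).
  have h := is_deriveM (is_derive1_powR (p - 4) t_gt0)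
    (is_deriveM (is_deriveB (is_deriveM did did) (is_derive_cst C t 1))
    (is_derive_virial gamma2_gt0 t_gt0 dF (euler (x t)) motion t0t)).
  refine (is_derive_eq h _); rewrite /GRing.scale/= ?fctE /Phi'.
  rewrite -/c -/p -/d (powR_pred (p - 4) t_gt0).
  by field; rewrite gt_eqF.
have bounds t : T <= t ->
    t ^+ 2 * energy F x v t / 2 <= virial c d F x v t
      <= 2 * (t ^+ 2 * energy F x v t).
  move=> /T_le[t0t t1 ct dt _]; apply: virial_bounds => //.
  exact/sqrF/ltW.
have virial0 t : T <= t -> 0 < virial c d F x v t.
  move=> Tt; have /andP[+ _] := bounds _ Tt; apply: lt_le_trans.
  have [t0t t1 _ _ _] := T_le _ Tt.
  have t_gt0 : 0 < t by lra.
  by rewrite divr_gt0// mulr_gt0 ?exprn_gt0 ?E0// ltW.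
have Phi'_ge0 t : T < t -> 0 <= Phi' t.
  move=> /ltW Tt; have [t0t t1 _ _ Ct] := T_le _ Tt.
  rewrite mulr_ge0 ?powR_ge0//.
  have /andP[lo _] := bounds _ Tt.
  have xE : x t ^+ 2 <= energy F x v t.
    by rewrite /energy (le_trans (sqrF _ (ltW t0t)))// lerDl divr_ge0 ?sqr_ge0.
  have CX : - (C * x t ^+ 2) <= (p - 2) * d * x t ^+ 2.
    rewrite -mulNr ler_wpM2r ?sqr_ge0// /C -mulrN mulrC ler_wpM2r//.
    by rewrite lerNl -normrN ler_norm.
  have tCX : (t ^+ 2 - C) * - (C * x t ^+ 2) <=
      (t ^+ 2 - C) * ((p - 2) * d * x t ^+ 2).
    by rewrite ler_wpM2l// subr_ge0 ltW.
  have CCX : 0 <= C * (C * x t ^+ 2) by rewrite mulr_ge0// mulr_ge0// sqr_ge0.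
  have tE : t ^+ 2 * x t ^+ 2 <= t ^+ 2 * energy F x v t.
    by rewrite ler_wpM2l ?sqr_ge0.
  have : C * (t ^+ 2 * x t ^+ 2) <= C * (2 * virial c d F x v t).
    by rewrite ler_wpM2l//; lra.
  lra.
have Phi_le : forall t, T <= t -> Phi T <= Phi t.
  have [t0T _ _ _ _] := T_le T (lexx T).
  move=> t; apply: (@is_derive_ge0_homo _ T Phi Phi') => // [u Tu|].
    exact/dPhi/(lt_trans t0T).
  apply: derivable_within_continuous => u; rewrite in_itv/= andbT => Tu.
  by have [] := dPhi _ (lt_le_trans t0T Tu).
exists (Phi T / 2), T.
have [t0T T1 _ _ CT] := T_le T (lexx T).
split; [|exact: ltW|].
  rewrite divr_gt0// /Phi; apply: mulr_gt0.
    by apply: powR_gt0; exact: lt_trans t0T.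
  by rewrite mulr_gt0 ?virial0// subr_gt0.
move=> t Tt; rewrite ler_pdivrMr//; apply: (le_trans (Phi_le _ Tt)).
have [t0t t1 _ _ Ct] := T_le t Tt.
have t_gt0 := lt_trans t00 t0t.
have /andP[_ hi] := bounds _ Tt.
have -> : t `^ p = t `^ (p - 4) * (t ^+ 2 * t ^+ 2).
  rewrite -exprD -powR_mulrn ?ltW// -powRD; first by rewrite subrK.
  by rewrite (gt_eqF t_gt0) implybT.
rewrite /Phi -!mulrA ler_wpM2l ?powR_ge0//.
apply: (@le_trans _ _ (t ^+ 2 * virial c d F x v t)).
  by rewrite ler_wpM2r ?(ltW (virial0 _ Tt))// lerBlDr lerDl.
have : t ^+ 2 * virial c d F x v t <=
  t ^+ 2 * (2 * (t ^+ 2 * energy F x v t)) by rewrite ler_wpM2l ?sqr_ge0.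
lra.
Qed.

(** * From the energy to the potential *)

(** A small potential means that most of the energy is kinetic, hence that x moves
    too fast to stay near 0, where a small potential confines it. *)
Lemma potential_lower_of_energy (R : realType) (t0 p m T0 : R) (F x v : R -> R) :
  0 < m -> 0 <= p -> (forall t, t0 < t -> is_derive t 1 x (v t)) ->
  (forall t, t0 < t -> x t ^+ 2 <= F (x t)) ->
  (forall t, T0 <= t -> m <= t `^ p * energy F x v t) ->
  forall T, exists t, [/\ T <= t, t0 <= t & m / 2 / t `^ p <= F (x t)].
Proof.
move=> m0 p0 dx sqrF Elo T.
have [//|none] := pselect (exists t, [/\ T <= t, t0 <= t & m / 2 / t `^ p <= F (x t)]).
(* The last summand ensures t^2 > 2 * 2^p, the threshold at which the distance
   travelled on [t, 2t] contradicts the confinement of x. *)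
pose t := `|t0| + `|T0| + `|T| + 1 + 2 * 2 `^ p.
have two_p : 0 < (2 : R) `^ p by exact: powR_gt0.
have := (ler_norm t0, ler_norm T0, ler_norm T).
have := (normr_ge0 t0, normr_ge0 T0, normr_ge0 T).
move=> [[? ?] ?] [[? ?] ?].
have t0t : t0 < t by rewrite /t; lra.
have T0t : T0 <= t by rewrite /t; lra.
have Tt : T <= t by rewrite /t; lra.
have t1 : 1 <= t by rewrite /t; lra.
have tp : 2 * 2 `^ p < t ^+ 2.
  apply: (@lt_le_trans _ _ t); first by rewrite /t; lra.
  by rewrite expr2 ler_peMr//; lra.
clearbody t.
have t_gt0 : 0 < t by lra.
have small s : t <= s -> F (x s) < m / 2 / s `^ p.
  move=> ts; rewrite ltNge; apply/negP => Fs; apply: none.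
  by exists s; split => //; lra.
have [s] : exists2 s, s \in `]t, (2 * t)[%R & x (2 * t) - x t = v s * (2 * t - t).
  apply: (MVT (f := x) (df := v)); first by lra.
    by move=> s; rewrite in_itv/= => /andP[ts _]; apply: dx; exact: lt_trans ts.
  apply: derivable_within_continuous => s; rewrite in_itv/= => /andP[ts _].
  by have [] := dx s (lt_le_trans t0t ts).
rewrite in_itv/= => /andP[ts st] slope.
have s_gt0 : 0 < s by lra.
have powV_le u w : 0 < u -> u <= w -> (w `^ p)^-1 <= (u `^ p)^-1.
  move=> u0 uw; have w0 := lt_le_trans u0 uw.
  rewrite lef_pV2 ?posrE ?powR_gt0//.
  by apply: ge0_ler_powR => //; rewrite nnegrE ltW.
have vs : m / (2 * t) `^ p <= v s ^+ 2.
  apply: (@le_trans _ _ (m / s `^ p)).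
    by apply: ler_wpM2l; [exact: ltW | apply: powV_le => //; exact: ltW].
  have := Elo s (le_trans T0t (ltW ts)); rewrite mulrC -ler_pdivrMr ?powR_gt0//.
  by have := small s (ltW ts); rewrite /energy; lra.
have t_le2t : t <= 2 * t by lra.
have Ft := small t (lexx t); have F2t := small (2 * t) t_le2t.
have xt := sqrF t t0t; have x2t := sqrF (2 * t) (lt_le_trans t0t t_le2t).
have tp_gt0 : 0 < t `^ p by exact: powR_gt0.
have tpV : (2 * t) `^ p = 2 `^ p * t `^ p by rewrite powRM// ltW.
have le_tpV : m / 2 / (2 * t) `^ p <= m / 2 / t `^ p.
  by apply: ler_wpM2l; [lra | exact: powV_le].
have upper : t ^+ 2 * v s ^+ 2 < 2 * (m / t `^ p).
  have -> : t ^+ 2 * v s ^+ 2 = (x (2 * t) - x t) ^+ 2 by rewrite slope; ring.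
  have := sqr_ge0 (x (2 * t) + x t); rewrite sqrrB sqrrD; lra.
have : t ^+ 2 * (m / (2 * t) `^ p) < 2 * (m / t `^ p).
  by apply: le_lt_trans upper; rewrite ler_wpM2l ?sqr_ge0.
have -> : t ^+ 2 * (m / (2 * t) `^ p) = t ^+ 2 / 2 `^ p * (m / t `^ p).
  by rewrite tpV; field; rewrite !gt_eqF.
rewrite ltr_pM2r ?divr_gt0// ltr_pdivrMr// => h.
by have := lt_trans h tp; rewrite ltxx.
Qed.

Theorem proposition4p3 (R : realType) (gamma alpha t0 : R) (F x : R -> R)
  (hgamma1 : 1 < gamma) (hgamma2 : gamma <= 2)
  (halpha : 0 < alpha)
  (hF : forall y : R, F y = `|y| `^ gamma)
  (ht0 : Num.sqrt (Num.max 0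
           (alpha * gamma * (alpha - 1 - 2 / gamma) / (gamma + 2) ^+ 2)) < t0)
  (hwp : cauchy_well_posed alpha t0 F)
  (hx : ode_solution alpha t0 F x)
  (hx0 : `|x t0| < 1)
  (hx0_neq0 : x t0 != 0)
  (hv0 : is_derive1_within `[t0, +oo[ x t0 0) :
  exists K : R, 0 < K /\
    forall T : R, 0 < T ->
      exists t : R, [/\ T <= t, t0 <= t &
        F (x t) - inf (range F) >= K / t `^ (2 * gamma * alpha / (gamma + 2))].
Proof.
have t0_gt0 : 0 < t0 by exact: le_lt_trans (sqrtr_ge0 _) ht0.
have FE : F = (fun y => `|y| `^ gamma) by apply/funext.
have [v [a ode]] := hx.
have x_within t : t0 <= t -> is_derive1_within `[t0, +oo[ x t (v t).
  by move=> /ode[].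
have v_within t : t0 <= t -> is_derive1_within `[t0, +oo[ v t (a t).
  by move=> /ode[].
have motion : damped_motion alpha t0 F x v.
  move=> t t0t; have [xt vt eq_t] := ode _ (ltW t0t).
  split; first exact: is_derive1_within_interior xt.
  have <- : a t = - (alpha / t * v t) - derive1 F (x t) by lra.
  exact: is_derive1_within_interior vt.
have xc := is_derive1_within_continuous x_within.
have vc := is_derive1_within_continuous v_within.
have v0 : v t0 = 0 := is_derive1_within_unique (x_within _ (lexx t0)) hv0.
have F_ge0 y : 0 <= F y by rewrite hF powR_ge0.
have dF y : derivable F y 1 by rewrite FE; have [] := is_derive_abs_powR y hgamma1.
have euler y : y * derive1 F y = gamma * F y.
  by rewrite FE; exact: abs_powR_euler.
have gamma0 : 0 < gamma by lra.
have E_t0 : energy F x v t0 = F (x t0) by rewrite /energy v0 expr0n mul0r addr0.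
have E_gt0 : forall t, t0 <= t -> 0 < energy F x v t.
  apply: (energy_gt0 (ltW halpha)) => //.
  by rewrite E_t0 hF powR_gt0// normr_gt0.
have sqrF t : t0 <= t -> x t ^+ 2 <= F (x t).
  move=> t0t; rewrite hF; apply: sqr_le_abs_powR => //.
  rewrite leNgt; apply/negP => x_gt1.
  have : F (x t0) < F (x t).
    by rewrite !hF gt0_ltr_powR ?nnegrE// (lt_trans hx0).
  apply/negP; rewrite -leNgt -E_t0.
  apply: (@le_trans _ _ (energy F x v t)); last first.
    exact: energy_nonincreasing (ltW halpha) (ltW t0_gt0) dF motion xc vc
      _ _ (lexx t0) t0t.
  by rewrite /energy lerDl divr_ge0 ?sqr_ge0.
have [m [T0 [m0 _ Elo]]] := energy_powR_lower gamma0 hgamma2 (ltW halpha)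
  t0_gt0 dF euler motion sqrF E_gt0.
exists (m / 2); split; first by rewrite divr_gt0.
move=> T _.
have -> : 2 * gamma * alpha / (gamma + 2) = gamma * (2 * alpha / (gamma + 2)) by ring.
have infF : inf (range F) = 0 by rewrite FE inf_abs_powR// gt_eqF.
have p_ge0 : 0 <= gamma * (2 * alpha / (gamma + 2)).
  by rewrite mulr_ge0 ?divr_ge0 ?mulr_ge0 ?addr_ge0// ltW.
have dx t : t0 < t -> is_derive t 1 x (v t) by case/motion.
have sqrF' t : t0 < t -> x t ^+ 2 <= F (x t) by move/ltW/sqrF.
have [t [Tt t0t Ft]] := potential_lower_of_energy m0 p_ge0 dx sqrF' Elo T.
by exists t; rewrite infF subr0.
Qed.
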